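(* Let $L, M, N$ be positive integers and $\sigma_w^2>0$. For each $n\in\{1,\dots,N\}$ let $\bm{s}_n\in\mathbb{C}^L$, $\overline{\bm{h}}_n\in\mathbb{C}^M$, and let $\bm{R}_n\in\mathbb{C}^{M\times M}$ be Hermitian positive semidefinite with $r_n=\operatorname{rank}(\bm{R}_n)$; let $\bm{R}_n^{1/2}\in\mathbb{C}^{M\times r_n}$ satisfy $\bm{R}_n^{1/2}(\bm{R}_n^{1/2})^H=\bm{R}_n$, and set $\bm{X}_n=\bm{R}_n^{1/2}\otimes\bm{s}_n\in\mathbb{C}^{LM\times r_n}$. Let $\bm{y}\in\mathbb{C}^{LM}$ be given. For $\bm{a}\in[0,1]^N$ define $$\bm{\Sigma}_{\bm{a}}=\sum_{n=1}^N a_n\,\bm{R}_n\otimes(\bm{s}_n\bm{s}_n^H)+\sigma_w^2\bm{I}_{LM},\qquad \overline{\bm{y}}_{\bm{a}}=\sum_{n=1}^N a_n\,\overline{\bm{h}}_n\otimes\bm{s}_n,$$ $$f(\bm{a})=\log|\bm{\Sigma}_{\bm{a}}|+(\bm{y}-\overline{\bm{y}}_{\bm{a}})^H\bm{\Sigma}_{\bm{a}}^{-1}(\bm{y}-\overline{\bm{y}}_{\bm{a}}).$$ Let $\ell>0$ be a Lipschitz constant of $\nabla f$ on $[0,1]^N$. For $\bm{a}\in[0,1]^N$ and $n\in\{1,\dots,N\}$, write $\bm{b}_n=\overline{\bm{h}}_n\otimes\bm{s}_n$, $\bm{r}=\bm{y}-\overline{\bm{y}}_{\bm{a}}$, $\bm{\Sigma}=\bm{\Sigma}_{\bm{a}}$,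 $\bm{G}_n=\bm{X}_n^H\bm{\Sigma}^{-1}\bm{X}_n$, and define the quartic polynomial in $d\in\mathbb{R}$ $$\begin{aligned}p_{\mathrm{approx}}(d)={}&f(\bm{a})+d\,\operatorname{tr}(\bm{G}_n)-2d\operatorname{Re}\big(\bm{r}^H\bm{\Sigma}^{-1}\bm{b}_n\big)+d^2\,\bm{b}_n^H\bm{\Sigma}^{-1}\bm{b}_n\\&-d\,\bm{r}^H\bm{\Sigma}^{-1}\bm{X}_n(\bm{I}_{r_n}-d\,\bm{G}_n)\bm{X}_n^H\bm{\Sigma}^{-1}\bm{r}\\&+2d^2\operatorname{Re}\big(\bm{r}^H\bm{\Sigma}^{-1}\bm{X}_n(\bm{I}_{r_n}-d\,\bm{G}_n)\bm{X}_n^H\bm{\Sigma}^{-1}\bm{b}_n\big)\\&-d^3\,\bm{b}_n^H\bm{\Sigma}^{-1}\bm{X}_n(\bm{I}_{r_n}-d\,\bm{G}_n)\bm{X}_n^H\bm{\Sigma}^{-1}\bm{b}_n.\end{aligned}$$ Then there exists a constant $c>0$ such that for every $\bm{a}\in[0,1]^N$, every $n\in\{1,\dots,N\}$ and every $\mu\ge \ell+c$, any minimizer $\bar d$ of $p_{\mathrm{approx}}(d)+\frac{\mu}{2}d^2$ over $d\in[-a_n,1-a_n]$ satisfies $$f(\bm{a}+\bar d\,\bm{e}_n)\le f(\bm{a})-\frac{[\mathcal{V}(\bm{a})]_n^2}{2(\mu+c)},$$ where $\bm{e}_n$ is the $n$-th standard basis vector of $\mathbb{R}^N$ and $\mathcal{V}(\bm{a})=\big|\operatorname{Proj}(\bm{a}-\nabla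 f(\bm{a}))-\bm{a}\big|\in\mathbb{R}^N_+$, with $\operatorname{Proj}$ the coordinatewise projection onto $[0,1]$ and $|\cdot|$ the coordinatewise absolute value.
   Context: $|\cdot|$ applied to a matrix denotes its determinant; $\otimes$ is the Kronecker product; $(\cdot)^H$ is conjugate transpose. The gradient of $f$ has components $[\nabla f(\bm{a})]_n=\operatorname{tr}(\bm{X}_n^H\bm{\Sigma}_{\bm{a}}^{-1}\bm{X}_n)-\|\bm{X}_n^H\bm{\Sigma}_{\bm{a}}^{-1}(\bm{y}-\overline{\bm{y}}_{\bm{a}})\|_2^2-2\operatorname{Re}\big((\bm{y}-\overline{\bm{y}}_{\bm{a}})^H\bm{\Sigma}_{\bm{a}}^{-1}(\overline{\bm{h}}_n\otimes\bm{s}_n)\big)$. The function $f$ is the negative log-likelihood (up to constants) of the MLE device activity detection problem, minimized over $\bm{a}\in[0,1]^N$. *)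

(* Defs.v *)
From HB Require Import structures.
From mathcomp Require Import all_boot all_order all_algebra.
From mathcomp Require Import all_classical all_reals all_analysis.
From mathcomp Require Import complex mxtens.
Set Implicit Arguments. Unset Strict Implicit. Unset Printing Implicit Defensive.
Import Order.TTheory GRing.Theory Num.Theory.
Local Open Scope ring_scope.

Definition ctmx {R : rcfType} {m n : nat} (A : 'M[R[i]]_(m, n)) : 'M[R[i]]_(n, m) :=
  (map_mx (@conjc R) A)^T.

Definition proj01 {R : realType} (x : R) : R := Num.max 0 (Num.min x 1).

Definition inbox {R : realType} {N : nat} (a : 'rV[R]_N) : Prop :=
  forall n : 'I_N, 0 <= a 0 n <= 1.

Definition norm2 {R : realType} {N : nat} (v : 'rV[R]_N) : R :=
  Num.sqrt (\sum_(n < N) v 0 n ^+ 2).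

Definition e_ {R : realType} {N : nat} (n : 'I_N) : 'rV[R]_N := delta_mx 0 n.

Section Model.
Variables (R : realType) (L M N : nat).
Variables (s : 'I_N -> 'cV[R[i]]_L) (hb : 'I_N -> 'cV[R[i]]_M)
          (Rm : 'I_N -> 'M[R[i]]_M) (r : 'I_N -> nat)
          (Rh : forall n : 'I_N, 'M[R[i]]_(M, r n))
          (sw2 : R) (y : 'cV[R[i]]_(M * L)).

Definition Xn (n : 'I_N) : 'M[R[i]]_(M * L, r n * 1) := Rh n *t s n.
Definition bn (n : 'I_N) : 'M[R[i]]_(M * L, 1 * 1) := hb n *t s n.

Definition Sigma (a : 'rV[R]_N) : 'M[R[i]]_(M * L) :=
  \sum_(n < N) ((a 0 n)%:C)%C *: (Rm n *t (s n *m ctmx (s n))) + ((sw2%:C)%C)%:M.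

Definition ybar (a : 'rV[R]_N) : 'cV[R[i]]_(M * L) :=
  \sum_(n < N) ((a 0 n)%:C)%C *: (hb n *t s n).

(* f(a) = log|Sigma_a| + (y - ybar_a)^H Sigma_a^{-1} (y - ybar_a)
   (both quantities are real; Re extracts the real value) *)
Definition fobj (a : 'rV[R]_N) : R :=
  ln (complex.Re (\det (Sigma a))) +
  complex.Re ((ctmx (y - ybar a) *m invmx (Sigma a) *m (y - ybar a)) 0 0).

Definition gradf (a : 'rV[R]_N) (n : 'I_N) : R :=
  derive1 (fun t : R => fobj (a + t *: e_ n)) 0.

Definition Vf (a : 'rV[R]_N) (n : 'I_N) : R :=
  `| proj01 (a 0 n - gradf a n) - a 0 n |.

Definition grad_lipschitz (ell : R) : Prop :=
  forall a b : 'rV[R]_N, inbox a -> inbox b ->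
    norm2 (\row_n (gradf a n - gradf b n)) <= ell * norm2 (a - b).

Definition p_approx (a : 'rV[R]_N) (n : 'I_N) (d : R) : R :=
  let Si := invmx (Sigma a) in
  let rr := y - ybar a in
  let b := bn n in
  let X := Xn n in
  let G := ctmx X *m Si *m X in
  let K := X *m (1%:M - (d%:C)%C *: G) *m ctmx X in
  fobj a + d * complex.Re (\tr G)
  - 2 * d * complex.Re ((ctmx rr *m Si *m b) 0 0)
  + d ^+ 2 * complex.Re ((ctmx b *m Si *m b) 0 0)
  - d * complex.Re ((ctmx rr *m Si *m K *m Si *m rr) 0 0)
  + 2 * d ^+ 2 * complex.Re ((ctmx rr *m Si *m K *m Si *m b) 0 0)
  - d ^+ 3 * complex.Re ((ctmx b *m Si *m K *m Si *m b) 0 0).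

End Model.

(* Main.v *)
Require Import Defs.
From HB Require Import structures.
From mathcomp Require Import all_boot all_order all_algebra.
From mathcomp Require Import all_classical all_reals all_analysis.
From mathcomp Require Import complex mxtens.
From mathcomp Require Import ring lra.
Set Implicit Arguments.
Unset Strict Implicit.
Unset Printing Implicit Defensive.
Import Order.TTheory GRing.Theory Num.Theory.
Import numFieldNormedType.Exports.
Local Open Scope ring_scope.
Local Open Scope complex_scope.

(** Write g for the n-th partial derivative of f at a. The quartic satisfies
    p(d) = f(a) + g d + O(d^2) for |d| <= 1, uniformly over the box, because
    Sigma_a >= sw2 I bounds every entry of the inverse of Sigma_a by 1 / sw2.
    With B the constant in the O, the descent lemma for the ell-Lipschitz gradient
    and mu >= ell + 2 B give, for the minimizer dbar and every feasible d,
      f(a + dbar e_n) <= f(a) + g dbar + ell/2 dbar^2 <= p(dbar) + mu/2 dbar^2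
                      <= p(d) + mu/2 d^2 <= f(a) + g d + (mu + 2 B)/2 d^2.
    Take d = v / (mu + c) with v = Proj(a_n - g) - a_n, for which g v <= - v^2. *)

(** * Conjugate transposes and Hermitian forms over [R[i]] *)

Section ConjugateTranspose.
Variable R : rcfType.
Local Notation C := R[i].

Lemma ctmxE m n (A : 'M[C]_(m, n)) i j : ctmx A i j = (A j i)^*.
Proof. by rewrite !mxE. Qed.

Lemma ctmxK m n (A : 'M[C]_(m, n)) : ctmx (ctmx A) = A.
Proof. by apply/matrixP => i j; rewrite !ctmxE conjcK. Qed.

Lemma ctmx_mul m n p (A : 'M[C]_(m, n)) (B : 'M[C]_(n, p)) :
  ctmx (A *m B) = ctmx B *m ctmx A.
Proof. by rewrite /ctmx map_mxM trmx_mul. Qed.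

Lemma ctmxD m n (A B : 'M[C]_(m, n)) : ctmx (A + B) = ctmx A + ctmx B.
Proof. by rewrite /ctmx map_mxD linearD. Qed.

Lemma ctmxB m n (A B : 'M[C]_(m, n)) : ctmx (A - B) = ctmx A - ctmx B.
Proof. by rewrite /ctmx map_mxB linearB. Qed.

Lemma ctmx_sum m n (I : finType) (A : I -> 'M[C]_(m, n)) :
  ctmx (\sum_i A i) = \sum_i ctmx (A i).
Proof. by rewrite /ctmx (raddf_sum (map_mx _)) linear_sum. Qed.

Lemma ctmxZr m n (t : R) (A : 'M[C]_(m, n)) : ctmx (t%:C *: A) = t%:C *: ctmx A.
Proof.
apply/matrixP => i j; rewrite ctmxE !mxE rmorphM; congr (_ * _).
exact: conjc_real.
Qed.

Lemma ctmx_scalar n (t : R) : ctmx (t%:C%:M : 'M[C]_n) = t%:C%:M.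
Proof. by rewrite /ctmx map_scalar_mx tr_scalar_mx /= oppr0. Qed.

Lemma ctmx_inv n (A : 'M[C]_n) : ctmx (invmx A) = invmx (ctmx A).
Proof. by rewrite /ctmx map_invmx trmx_inv. Qed.

Lemma ctmx_tens m n p q (A : 'M[C]_(m, n)) (B : 'M[C]_(p, q)) :
  ctmx (A *t B) = ctmx A *t ctmx B.
Proof. by rewrite /ctmx map_mxT trmx_tens. Qed.

Lemma Re_ctmx m n (A : 'M[C]_(m, n)) i j :
  complex.Re (ctmx A i j) = complex.Re (A j i).
Proof. by rewrite ctmxE; case: (A j i). Qed.

Lemma ReZr (t : R) (z : C) : complex.Re (t%:C * z) = t * complex.Re z.
Proof. by case: z => x y /=; rewrite mul0r subr0. Qed.

Lemma mul_ctmx_cV n (v : 'cV[C]_n) : (ctmx v *m v) 0 0 = \sum_i `|v i 0| ^+ 2.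
Proof.
by rewrite mxE; apply: eq_bigr => i _; rewrite ctmxE mulrC sqr_normc.
Qed.

Lemma mul_ctmx_cV_ge0 n (v : 'cV[C]_n) : 0 <= (ctmx v *m v) 0 0.
Proof. by rewrite mul_ctmx_cV sumr_ge0 // => i _; rewrite exprn_ge0. Qed.

Lemma mul_ctmx_cV_eq0 n (v : 'cV[C]_n) : (ctmx v *m v) 0 0 = 0 -> v = 0.
Proof.
rewrite mul_ctmx_cV => /eqP; rewrite psumr_eq0 => [/allP v0|i _]; last first.
  by rewrite exprn_ge0.
apply/matrixP => i j; rewrite ord1 mxE.
by have := v0 i (mem_index_enum i); rewrite sqrf_eq0 normr_eq0 => /eqP.
Qed.

(** Every entry of [W] has modulus at most [w], the sum of all the moduli, and
    [N i * N j <= (N i ^+ 2 + N j ^+ 2) / 2]; summing over both indices gives the crude constant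
    [w *+ n]. *)
Lemma quadform_bound n (W : 'M[C]_n) : exists2 K : R, 0 <= K &
  forall v : 'cV[C]_n, `|(ctmx v *m W *m v) 0 0| <= K%:C * (ctmx v *m v) 0 0.
Proof.
pose w : C := \sum_i \sum_j `|W i j|.
have w0 : 0 <= w by apply: sumr_ge0 => i _; apply: sumr_ge0 => j _.
have wW i j : `|W i j| <= w.
  rewrite /w (bigD1 i) //= (bigD1 j) //= -addrA lerDl addr_ge0 //.
    exact: sumr_ge0.
  by apply: sumr_ge0 => k _; apply: sumr_ge0.
have [K wE] : exists K : R, w *+ n = K%:C.
  by apply/complex_realP; rewrite rpredMn// ger0_real.
exists K; first by rewrite -ler0c -wE mulrn_wge0.
move=> v; rewrite -wE mul_ctmx_cV -mulmxA mxE.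
pose N i := `|v i 0|.
have -> : w *+ n * (\sum_i `|v i 0| ^+ 2) =
    \sum_i \sum_j w / 2 * (N i ^+ 2 + N j ^+ 2).
  under [RHS]eq_bigr do rewrite -mulr_sumr big_split /= sumr_const card_ord.
  rewrite -mulr_sumr big_split /= sumr_const card_ord sumrMnl.
  move: (\sum_i _) => S; rewrite -mulr2n -mulr_natr -[S *+ n]mulr_natr.
  by rewrite mulr2n -mulr_natr; field.
apply: le_trans (ler_norm_sum _ _ _) _; apply: ler_sum => i _.
rewrite ctmxE mxE mulr_sumr; apply: le_trans (ler_norm_sum _ _ _) _.
apply: ler_sum => j _; rewrite !normrM normcJ.
have h : 0 <= (N i - N j) ^+ 2.
  by rewrite real_exprn_even_ge0 // rpredB // normr_real.
apply: (@le_trans _ _ (w * (N i * N j))).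
  rewrite mulrCA; apply: ler_wpM2r => //; by rewrite mulr_ge0.
rewrite -mulrA; apply: ler_wpM2l => //.
rewrite -subr_ge0; have -> : 2^-1 * (N i ^+ 2 + N j ^+ 2) - N i * N j =
  2^-1 * (N i - N j) ^+ 2 by field.
by rewrite mulr_ge0 // invr_ge0.
Qed.

End ConjugateTranspose.

(** * Coercive Hermitian matrices: invertibility, determinant, entries of the inverse *)

(** The order on [R[i]] only compares numbers with equal imaginary parts, so the inequality also
    says that the form of [A] is real. *)
Definition coercive {R : rcfType} {n : nat} (k : R) (A : 'M[R[i]]_n) : Prop :=
  forall v : 'cV[R[i]]_n, k%:C * (ctmx v *m v) 0 0 <= (ctmx v *m A *m v) 0 0.

Section Coercive.
Variables (R : rcfType) (n : nat) (k : R) (A : 'M[R[i]]_n).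
Hypotheses (k_gt0 : 0 < k) (hermA : ctmx A = A) (coercA : coercive k A).
Local Notation C := R[i].

Let kC_gt0 : 0 < k%:C. Proof. by rewrite ltcR. Qed.

Lemma coercive_unitmx : A \in unitmx.
Proof.
rewrite -unitmx_tr -row_free_unit -kermx_eq0; apply/rowV0P => u.
move=> /sub_kermxP uA0.
have Au0 : A *m u^T = 0 by rewrite -[A]trmxK -trmx_mul uA0 trmx0.
have := coercA u^T; rewrite -mulmxA Au0 mulmx0 [leRHS]mxE pmulr_rle0 // => le0.
have /mul_ctmx_cV_eq0/(congr1 trmx) : (ctmx u^T *m u^T) 0 0 = 0.
  by apply/le_anti; rewrite le0 mul_ctmx_cV_ge0.
by rewrite trmxK trmx0.
Qed.

(** By the spectral theorem the determinant is the product of the eigenvalues, and each eigenvalue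
    is the form at a unit eigenvector, hence at least [k]. *)
Lemma coercive_det_gt0 : 0 < \det A.
Proof.
have /hermitian_normalmx/orthomx_spectralP : A \is hermsymmx.
  by apply/is_hermitianmxP; rewrite expr0 scale1r -map_trmx -[LHS]hermA.
set P := spectralmx A; set d := spectral_diag A => AE.
have PU : P \in unitmx by exact: spectral_unit.
have PPH : P *m ctmx P = 1%:M.
  by rewrite /ctmx map_trmx; apply/unitarymxP/spectral_unitarymx.
rewrite AE !det_mulmx mulrAC -det_mulmx mulVmx // det1 mul1r det_diag.
apply: prodr_gt0 => i _.
(* An eigenvector for [d 0 i], of norm one because [P] is unitary. *)
pose v := ctmx P *m delta_mx i 0 : 'cV[C]_n.
have vE : ctmx v = delta_mx 0 i *m P.
  rewrite ctmx_mul ctmxK; congr (_ *m _); apply/matrixP => a b.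
  by rewrite ctmxE !mxE andbC; case: (_ && _); rewrite /= oppr0.
have Pv : P *m v = delta_mx i 0 by rewrite /v mulmxA PPH mul1mx.
have invP : invmx P = ctmx P by rewrite -[RHS]mul1mx -(mulVmx PU) -mulmxA PPH mulmx1.
have vv : (ctmx v *m v) 0 0 = 1.
  by rewrite vE -mulmxA Pv mul_delta_mx mxE eqxx.
have vAv : (ctmx v *m A *m v) 0 0 = d 0 i.
  rewrite vE AE invP -!mulmxA Pv (mulmxA P) PPH mul1mx -rowE -colE.
  by rewrite !mxE eqxx.
by have := coercA v; rewrite vv vAv mulr1; apply: lt_le_trans.
Qed.

(* The column w = A^-1 e_j satisfies w_j^* = w^H A w >= k |w|^2, which first bounds
   w_j and then every w_i. *)
Lemma coercive_invmx_bound i j : `|invmx A i j| <= (k^-1)%:C.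
Proof.
pose w := invmx A *m delta_mx j 0 : 'cV[C]_n.
have Aw : A *m w = delta_mx j 0 by rewrite mulKVmx // coercive_unitmx.
have wE l : w l 0 = invmx A l j by rewrite /w -colE mxE.
have qw : (ctmx w *m A *m w) 0 0 = (w j 0)^*.
  by rewrite -mulmxA Aw -colE mxE ctmxE.
have lew l : k%:C * `|w l 0| ^+ 2 <= `|w j 0|.
  have q0 : 0 <= (ctmx w *m A *m w) 0 0.
    apply: le_trans (coercA w).
    by rewrite mulr_ge0 ?mul_ctmx_cV_ge0 // ltW.
  rewrite -[leRHS]normcJ -qw (ger0_norm q0).
  apply: le_trans (coercA w); rewrite ler_pM2l // mul_ctmx_cV (bigD1 l) //=.
  by rewrite lerDl sumr_ge0 // => m _; rewrite exprn_ge0.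
have lewj : `|w j 0| <= (k^-1)%:C.
  have [->|w0] := eqVneq (w j 0) 0; first by rewrite normr0 ler0c invr_ge0 ltW.
  rewrite fmorphV -[leRHS]mul1r ler_pdivlMr // mulrC.
  by rewrite -(ler_pM2r (_ : 0 < `|w j 0|)) ?normr_gt0 // mul1r -mulrA -expr2.
have kV0 : 0 <= (k^-1)%:C by rewrite ler0c invr_ge0 ltW.
rewrite -wE -ler_sqr ?nnegrE //.
rewrite -(ler_pM2l kC_gt0); apply: le_trans (lew i) _.
apply: le_trans lewj _.
by rewrite fmorphV expr2 mulrA divff ?mul1r // gt_eqF.
Qed.

End Coercive.

(** * Uniformly bounded families of matrices *)

(** The set [D] will be either the small parameters of a coordinate line or the points of the
    box. *)
Definition mxbounded {R : rcfType} {T : Type} (D : T -> Prop) {m n : nat}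
    (A : T -> 'M[R[i]]_(m, n)) : Prop :=
  exists B : R, forall t, D t -> forall i j, `|A t i j| <= B%:C.

Section BoundedFamilies.
Variables (R : rcfType) (T : Type) (D : T -> Prop).
Local Notation C := R[i].

Lemma mxbounded_cst m n (A : 'M[C]_(m, n)) : mxbounded D (fun=> A).
Proof.
have /complex_realP [B BE] : \sum_i \sum_j `|A i j| \is Num.real.
  by apply: rpred_sum => i _; apply: rpred_sum => j _; apply: normr_real.
exists B => t _ i j; rewrite -BE (bigD1 i) //= (bigD1 j) //= -addrA lerDl.
rewrite addr_ge0 ?sumr_ge0 // => k _; exact: sumr_ge0.
Qed.

Lemma mxboundedD m n (A B : T -> 'M[C]_(m, n)) :
  mxbounded D A -> mxbounded D B -> mxbounded D (fun t => A t + B t).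
Proof.
move=> [a Aa] [b Bb]; exists (a + b) => t Dt i j; rewrite mxE.
apply: le_trans (ler_normD _ _) _; rewrite rmorphD /=.
by apply: lerD; [apply: Aa|apply: Bb].
Qed.

Lemma mxboundedN m n (A : T -> 'M[C]_(m, n)) :
  mxbounded D A -> mxbounded D (fun t => - A t).
Proof. by move=> [a Aa]; exists a => t Dt i j; rewrite mxE normrN Aa. Qed.

Lemma mxbounded_sum m n (I : finType) (A : I -> T -> 'M[C]_(m, n)) :
  (forall i, mxbounded D (A i)) -> mxbounded D (fun t => \sum_i A i t).
Proof.
move=> /choice [a Aa]; exists (\sum_i a i) => t Dt i j.
rewrite summxE rmorph_sum; apply: le_trans (ler_norm_sum _ _ _) _.
by apply: ler_sum => k _; apply: Aa.
Qed.

Lemma mxboundedM m n p (A : T -> 'M[C]_(m, n)) (B : T -> 'M[C]_(n, p)) :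
  mxbounded D A -> mxbounded D B -> mxbounded D (fun t => A t *m B t).
Proof.
move=> [a Aa] [b Bb]; exists (a * b *+ n) => t Dt i j; rewrite mxE.
apply: le_trans (ler_norm_sum _ _ _) _.
rewrite -[n in _ *+ n]card_ord -sumr_const rmorph_sum; apply: ler_sum => k _.
by rewrite normrM rmorphM /=; apply: ler_pM => //; [apply: Aa|apply: Bb].
Qed.

Lemma mxboundedZ m n (c : T -> R) (A : T -> 'M[C]_(m, n)) :
  (forall t, D t -> `|c t| <= 1) -> mxbounded D A ->
  mxbounded D (fun t => (c t)%:C *: A t).
Proof.
move=> c1 [a Aa]; exists a => t Dt i j; rewrite mxE normrM -[leRHS]mul1r.
apply: ler_pM => //; last exact: Aa.
by rewrite normc_def /= expr0n addr0 sqrtr_sqr -[1]/(1%:C) lecR c1.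
Qed.

Lemma mxbounded_ctmx m n (A : T -> 'M[C]_(m, n)) :
  mxbounded D A -> mxbounded D (fun t => ctmx (A t)).
Proof. by move=> [a Aa]; exists a => t Dt i j; rewrite ctmxE normcJ Aa. Qed.

Lemma mxbounded_Re m n (A : T -> 'M[C]_(m, n)) i j : mxbounded D A ->
  exists2 B : R, 0 <= B & forall t, D t -> `|complex.Re (A t i j)| <= B.
Proof.
(* If [D] is empty, [a] may be negative. *)
move=> [a Aa]; exists `|a| => // t Dt; apply: le_trans (ler_norm a).
by rewrite -lecR; apply: le_trans (normc_ge_Re _) (Aa _ Dt _ _).
Qed.

End BoundedFamilies.

(** * Second-order expansion of the determinant *)

Lemma char_poly_horner (F : comNzRingType) n (A : 'M[F]_n) x :
  (char_poly A).[x] = \det (x%:M - A).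
Proof.
rewrite -horner_evalE -det_map_mx; congr (\det _); apply/matrixP => i j.
by rewrite /char_poly_mx !mxE /= /horner_eval !(hornerE, hornerMn).
Qed.

(* For t != 0, det (1 + t A) is t^n times the characteristic polynomial of - A at
   1 / t, so its coefficients are those of the characteristic polynomial reversed. *)
Lemma det_1DZ (F : fieldType) n (A : 'M[F]_n) : exists p : {poly F},
  forall t, \det (1%:M + t *: A) = 1 + t * \tr A + t ^+ 2 * p.[t].
Proof.
case: n A => [|n] A.
  by exists 0 => t; rewrite det_mx00 /mxtrace big_ord0 horner0 !mulr0 !addr0.
pose c k := (char_poly (- A))`_k.
(* The size is now [n.+1]. The two leading coefficients [c n.+1] and [c n] give the terms [1] and
   [t * \tr A]; the remaining ones, reversed and shifted by two, form the witness. *)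
exists (\poly_(k < n) c (n.-1 - k)%N) => t.
have c1 : c n.+1 = 1.
  by have /monicP := char_poly_monic (- A); rewrite lead_coefE size_char_poly.
have c2 : c n = \tr A.
  by rewrite /c -[n in LHS]/(n.+1.-1) char_poly_trace // linearN opprK.
have -> : \det (1%:M + t *: A) = \sum_(k < n.+2) c k * t ^+ (n.+1 - k).
  have [->|t0] := eqVneq t 0.
    rewrite scale0r addr0 det1 big_ord_recr /= subnn expr0 mulr1 c1 big1 ?add0r//.
    by move=> k _; rewrite expr0n subn_eq0 leqNgt ltn_ord mulr0.
  have -> : 1%:M + t *: A = t *: (t^-1%:M - (- A)).
    by rewrite opprK scalerDr scale_scalar_mx divff.
  rewrite detZ -char_poly_horner (horner_coef_wide (n := n.+2)) ?size_char_poly//.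
  rewrite mulr_sumr; apply: eq_bigr => k _; rewrite mulrCA; congr (_ * _).
  by rewrite exprVn -expfB_cond // (negPf t0) -ltnS ltn_ord.
rewrite !big_ord_recr /= subnn subSnn expr0 expr1 mulr1 c1 c2.
rewrite horner_poly [RHS]addrC [1 + _]addrC addrA [t * _]mulrC.
congr (_ + _ + _); rewrite mulr_sumr.
move: c {c1 c2} => c; case: n A c => [|n] A c; first by rewrite !big_ord0.
rewrite [RHS](reindex_inj rev_ord_inj) /=; apply: eq_bigr => k _.
have kn : (k <= n)%N by rewrite -ltnS.
rewrite subSS subKn // mulrCA -exprD; congr (_ * _ ^+ _).
by rewrite (addnBA 2 kn).
Qed.

(** * One-variable calculus *)

(** Divided by [h], the error is still of order [h]. Derivatives can thus be read off from algebraic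
    expansions, without differentiating matrix-valued functions. *)
Lemma is_derive_quadratic (R : realType) (g : R -> R) (x l e K : R) : 0 < e ->
  (forall h, `|h| < e -> `|g (x + h) - g x - l * h| <= K * h ^+ 2) ->
  is_derive x 1 g l.
Proof.
move=> e0 gq.
suff gl : ((fun h => h^-1 *: ((g \o shift x) (h *: 1) - g x)) @ 0^' --> l)%classic.
  by split; [apply/cvg_ex; exists l | apply/cvg_lim].
apply/cvgrPdist_le => eps eps0; near=> h.
have h0 : h != 0 by near: h; exact: nbhs_dnbhs_neq.
have he : `|h| < e.
  by near: h; apply: dnbhs0_lt.
(* The sign of [K] is unknown and [K] may vanish, so [|K| + 1] is the denominator. *)
have K0 : 0 < `|K| + 1 by apply: ltr_wpDl.
have hK : `|h| < eps / (`|K| + 1).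
  by near: h; apply: dnbhs0_lt; apply: divr_gt0.
rewrite /= /shift [h *: 1]mulr1 (addrC h) distrC.
have -> : h^-1 *: (g (x + h) - g x) - l = h^-1 * (g (x + h) - g x - l * h).
  rewrite [_ *: _]/(_ * _) mulrBr; congr (_ - _).
  by field.
rewrite normrM normrV ?unitfE // mulrC ler_pdivrMr ?normr_gt0 //.
apply: le_trans (gq h he) _; rewrite -[h ^+ 2]real_normK ?num_real //.
rewrite expr2 mulrA ler_pM2r ?normr_gt0 //.
move: hK; rewrite ltr_pdivlMr // => hK; apply: le_trans (ltW hK).
rewrite mulrC; apply: ler_wpM2l => //.
by apply: le_trans (ler_norm _) _; rewrite lerDl.
Unshelve. all: by end_near.
Qed.

(** Subtracting the parabola [t * dg 0 + K / 2 * t ^+ 2] from [g] leaves a function with nonpositive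
    derivative; the mean value theorem compares its values at 0 and 1. *)
Lemma descent_unit_interval (R : realType) (g dg : R -> R) (K : R) :
  (forall t : R, 0 <= t <= 1 -> is_derive t 1 g (dg t)) ->
  (forall t : R, 0 <= t <= 1 -> dg t - dg 0 <= K * t) ->
  g 1 <= g 0 + dg 0 + K / 2.
Proof.
move=> gd dgK; pose h (t : R) := g t - (t * dg 0 + K / 2 * t ^+ 2).
have hd (t : R) : 0 <= t <= 1 -> is_derive t 1 h (dg t - (dg 0 + K * t)).
  move=> t01; have gdt := gd t t01.
  have -> : h = g - ((fun t : R => t * dg 0) + (fun t : R => K / 2 * t ^+ 2)).
    by apply/funext.
  apply: is_deriveB; apply: is_deriveD.
    by apply: is_derive_eq; rewrite /GRing.scale /= mulr1 mulr0 add0r.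
  apply: is_derive_eq; rewrite /GRing.scale /=.
  by field.
have [|||c c01 hE] := @MVT R h (fun t : R => dg t - (dg 0 + K * t)) 0 1.
- exact: ltr01.
- by move=> t; rewrite in_itv /= => /andP[t0 t1]; apply: hd; rewrite !ltW.
- apply: derivable_within_continuous => t; rewrite in_itv /= => t01.
  by have [] := hd t t01.
have c01' : 0 <= c <= 1 by move: c01; rewrite in_itv /= => /andP[? ?]; rewrite !ltW.
by move: hE (dgK c c01'); rewrite /h; lra.
Qed.

(** * Real parts of sesquilinear forms, and remainder estimates *)

Definition Reform {R : rcfType} {n : nat} (A : 'M[R[i]]_n) (u v : 'cV[R[i]]_n) : R :=
  complex.Re ((ctmx u *m A *m v) 0 0).

Section Reform.
Variables (R : rcfType) (n : nat).
Implicit Types (A B : 'M[R[i]]_n) (u v w : 'cV[R[i]]_n) (t : R).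

Lemma ReB (x z : R[i]) : complex.Re (x - z) = complex.Re x - complex.Re z.
Proof. by case: x; case: z. Qed.

Lemma ReD (x z : R[i]) : complex.Re (x + z) = complex.Re x + complex.Re z.
Proof. by case: x; case: z. Qed.

Lemma ReformBl A u v w t :
  Reform A (u - t%:C *: w) v = Reform A u v - t * Reform A w v.
Proof.
by rewrite /Reform ctmxB ctmxZr !mulmxBl -!scalemxAl mxE [in X in _ + X]mxE
  [in X in _ - X]mxE ReB ReZr.
Qed.

Lemma ReformBr A u v w t :
  Reform A u (v - t%:C *: w) = Reform A u v - t * Reform A u w.
Proof.
by rewrite /Reform mulmxBr -!scalemxAr mxE [in X in _ + X]mxE
  [in X in _ - X]mxE ReB ReZr.
Qed.

Lemma ReformB A B u v t :
  Reform (A - t%:C *: B) u v = Reform A u v - t * Reform B u v.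
Proof.
by rewrite /Reform mulmxBr -!scalemxAr mulmxBl -!scalemxAl mxE [in X in _ + X]mxE
  [in X in _ - X]mxE ReB ReZr.
Qed.

Lemma ReformC A u v : ctmx A = A -> Reform A u v = Reform A v u.
Proof. by move=> hA; rewrite /Reform -Re_ctmx !ctmx_mul hA ctmxK mulmxA. Qed.

(** The matrix has the shape that [invmx_perturb] gives to the inverse along a line, with [u] the
    residual and [w] its rate of decrease. Hermitian symmetry of [A] merges its two cross terms. *)
Lemma Reform_expansion A P Q u w t : ctmx A = A ->
  Reform (A - t%:C *: (P - t%:C *: Q)) (u - t%:C *: w) (u - t%:C *: w) =
  Reform A u u + (- 2 * Reform A u w - Reform P u u) * t +
  (Reform A w w + Reform P w u + Reform P u w + Reform Q u u
    - t * (Reform P w w + Reform Q w u + Reform Q u w)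
    + t ^+ 2 * Reform Q w w) * t ^+ 2.
Proof.
move=> hA; rewrite !ReformB !ReformBl !ReformBr (ReformC w u hA).
move: (Reform A u u) (Reform A u w) (Reform A w w) (Reform P u u) (Reform P u w)
  (Reform P w u) (Reform P w w) (Reform Q u u) (Reform Q u w) (Reform Q w u)
  (Reform Q w w) => *.
ring.
Qed.

Lemma mxbounded_Reform (T : Type) (D : T -> Prop) (A : T -> 'M[R[i]]_n)
    (u v : T -> 'cV[R[i]]_n) :
  mxbounded D A -> mxbounded D u -> mxbounded D v ->
  exists2 B : R, 0 <= B & forall x, D x -> `|Reform (A x) (u x) (v x)| <= B.
Proof.
move=> bA bu bv.
apply: (@mxbounded_Re _ _ _ _ _ (fun x => ctmx (u x) *m A x *m v x)).
by do 2![apply: mxboundedM => //]; apply: mxbounded_ctmx.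
Qed.

End Reform.

Lemma Re_horner_bound (R : rcfType) (p : {poly R[i]}) : exists B : R,
  forall t : R, `|t| <= 1 -> `|complex.Re p.[t%:C]| <= B.
Proof.
have /complex_realP [B BE] : \sum_(i < size p) `|p`_i| \is Num.real.
  by apply: rpred_sum => i _; apply: normr_real.
exists B => t t1; rewrite -lecR -BE; apply: le_trans (normc_ge_Re _) _.
rewrite horner_coef; apply: le_trans (ler_norm_sum _ _ _) _.
apply: ler_sum => i _; rewrite normrM normrX ler_piMr // exprn_ile1 //.
by rewrite normc_def /= expr0n addr0 sqrtr_sqr -[1]/(1%:C) lecR.
Qed.

(** The resolvent identity is used once from each side. The result is exact: the perturbed inverse
    stays in the last term, so no series has to converge. *)
Lemma invmx_perturb (F : fieldType) n (A W : 'M[F]_n) t :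
  A \in unitmx -> A + t *: W \in unitmx ->
  let Ai := invmx A in
  invmx (A + t *: W) =
    Ai - t *: (Ai *m W *m Ai - t *: (Ai *m W *m invmx (A + t *: W) *m W *m Ai)).
Proof.
move=> uA uB; set B := A + _ in uB *; rewrite /=; set Ai := invmx A.
have BA : B - A = t *: W by rewrite /B addrC addKr.
have e1 : invmx B = Ai - t *: (Ai *m W *m invmx B).
  rewrite scalemxAl scalemxAr -BA mulmxBr mulVmx // mulmxBl mul1mx.
  by rewrite -mulmxA mulmxV // mulmx1 opprB addrC subrK.
have e2 : invmx B = Ai - t *: (invmx B *m W *m Ai).
  rewrite scalemxAl scalemxAr -BA mulmxBr mulVmx // mulmxBl mul1mx.
  by rewrite -mulmxA mulmxV // mulmx1 opprB addrC subrK.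
by rewrite {1}e1 {1}e2 mulmxBr -scalemxAr !mulmxA.
Qed.

(** The [k]s stand for fixed coefficients and the [q]s for those known only through bounds;
    [|h| <= 1] absorbs the powers of [h] beyond the second. *)
Lemma quartic_remainder_bound (R : realFieldType)
    (h x z k1 k2 q1 q2 q3 q4 B1 B2 B3 B4 : R) :
  `|h| <= 1 -> `|q1| <= B1 -> `|q2| <= B2 -> `|q3| <= B3 -> `|q4| <= B4 ->
  `|x + z * h + (k1 + q1 - h * (k2 + q2 + q3) + h ^+ 2 * q4) * h ^+ 2 - x - z * h|
  <= (`|k1| + `|k2| + B1 + B2 + B3 + B4) * h ^+ 2.
Proof.
move=> h1 b1 b2 b3 b4; set w := k1 + q1 - _ + _.
rewrite (_ : _ - _ - _ = w * h ^+ 2); last by ring.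
rewrite normrM [`|h ^+ 2|]ger0_norm ?sqr_ge0 // ler_wpM2r ?sqr_ge0 //.
have le1 (u v B : R) : `|u| <= 1 -> `|v| <= B -> `|u * v| <= B.
  by move=> u1 vB; rewrite normrM -[leRHS]mul1r; apply: ler_pM.
have h2 : `|h ^+ 2| <= 1 by rewrite normrX exprn_ile1.
have t4 := le1 _ _ _ h2 b4.
have t3 : `|h * (k2 + q2 + q3)| <= `|k2| + B2 + B3.
  apply: le1 => //; apply: le_trans (ler_normD _ _) _; apply: lerD b3.
  by apply: le_trans (ler_normD _ _) _; apply: lerD b2.
have t2 : `|k1 + q1| <= `|k1| + B1.
  by apply: le_trans (ler_normD _ _) _; apply: lerD b1.
have t5 := ler_normB (k1 + q1) (h * (k2 + q2 + q3)).
have := ler_normD (k1 + q1 - h * (k2 + q2 + q3)) (h ^+ 2 * q4).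
rewrite -/w; lra.
Qed.

Lemma quartic_tail_bound (R : realFieldType)
    (d g0 g x1 x2 x3 x4 x5 x6 B1 B2 B3 B4 B5 B6 : R) :
  `|d| <= 1 -> `|x1| <= B1 -> `|x2| <= B2 -> `|x3| <= B3 -> `|x4| <= B4 ->
  `|x5| <= B5 -> `|x6| <= B6 ->
  `|g0 + g * d + (x1 + x2 + 2 * x3) * d ^+ 2 - (2 * x4 + x5) * d ^+ 3
    + x6 * d ^+ 4 - g0 - g * d| <=
  (B1 + B2 + 2 * B3 + (2 * B4 + B5) + B6) * d ^+ 2.
Proof.
move=> d1 h1 h2 h3 h4 h5 h6.
have k1B : `|x1 + x2 + 2 * x3| <= B1 + B2 + 2 * B3.
  move: h1 h2 h3; rewrite !ler_norml => /andP[? ?] /andP[? ?] /andP[? ?].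
  by apply/andP; split; lra.
have k2B : `|2 * x4 + x5| <= 2 * B4 + B5.
  move: h4 h5; rewrite !ler_norml => /andP[? ?] /andP[? ?].
  by apply/andP; split; lra.
have k30 : `|0 : R| <= 0 by rewrite normr0.
(* All coefficients vary with the base point here, so they take the places of the [q]s, and both
   [k]s are 0. *)
have := quartic_remainder_bound g0 g 0 0 d1 k1B k2B k30 h6.
by rewrite !normr0 !add0r !addr0; apply: le_trans; rewrite le_eqVlt;
  apply/orP; left; apply/eqP; congr (Num.norm _); ring.
Qed.

(** * Derivatives of the objective along a coordinate line *)

Section Model.
Variables (R : realType) (L M N : nat).
Variables (s : 'I_N -> 'cV[R[i]]_L) (hb : 'I_N -> 'cV[R[i]]_M)
          (Rm : 'I_N -> 'M[R[i]]_M) (r : 'I_N -> nat)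
          (Rh : forall n : 'I_N, 'M[R[i]]_(M, r n))
          (sw2 : R) (y : 'cV[R[i]]_(M * L)).
Hypotheses (sw2_gt0 : 0 < sw2)
           (RhE : forall n, Rh n *m ctmx (Rh n) = Rm n).

Local Notation Sg := (Sigma s Rm sw2).
Local Notation res a := (y - ybar s hb a).
Local Notation Xm := (Xn s Rh).
Implicit Types (a : 'rV[R]_N) (t : R).
Local Notation b n := (bn s hb n : 'cV_(M * L)).
Local Notation f := (fobj s hb Rm sw2 y).

Definition Wn (n : 'I_N) : 'M[R[i]]_(M * L) := Rm n *t (s n *m ctmx (s n)).

(** The mixed-product rule for Kronecker products. The factorization makes [Wn n] Hermitian and
    positive semidefinite. *)
Lemma Xn_ctmx n : Xm n *m ctmx (Xm n) = Wn n.
Proof. by rewrite /Xn ctmx_tens tensmx_mul RhE. Qed.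

Lemma ctmx_Wn n : ctmx (Wn n) = Wn n.
Proof. by rewrite -Xn_ctmx ctmx_mul ctmxK. Qed.

Lemma Wn_psd n (v : 'cV_(M * L)) : 0 <= (ctmx v *m Wn n *m v) 0 0.
Proof.
rewrite -Xn_ctmx (_ : _ *m v = ctmx (ctmx (Xm n) *m v) *m (ctmx (Xm n) *m v)).
  exact: mul_ctmx_cV_ge0.
by rewrite ctmx_mul ctmxK !mulmxA.
Qed.

Lemma ctmx_Sigma a : ctmx (Sg a) = Sg a.
Proof.
rewrite /Sigma ctmxD ctmx_scalar ctmx_sum; congr (_ + _).
by apply: eq_bigr => n _; rewrite ctmxZr ctmx_Wn.
Qed.

(** Stated in an arbitrary module so as to serve both [Sigma] and [ybar]. *)
Lemma sum_line_step (V : lmodType R[i]) (F : 'I_N -> V) a n t :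
  \sum_(m < N) ((a + t *: e_ n) 0 m)%:C *: F m =
  \sum_(m < N) (a 0 m)%:C *: F m + t%:C *: F n.
Proof.
under eq_bigr do rewrite !mxE rmorphD scalerDl.
rewrite big_split /=; congr (_ + _).
rewrite (bigD1 n) //= eqxx mulr1 big1 ?addr0 // => m mn.
by rewrite (negPf mn) mulr0 scale0r.
Qed.

Lemma Sigma_line a n t : Sg (a + t *: e_ n) = Sg a + t%:C *: Wn n.
Proof. by rewrite /Sigma sum_line_step addrAC. Qed.

Lemma res_line a n t : res (a + t *: e_ n) = res a - t%:C *: b n.
Proof. by rewrite /ybar sum_line_step opprD addrA. Qed.

Lemma Sigma_coercive a : (forall n, 0 <= a 0 n) -> coercive sw2 (Sg a).
Proof.
move=> a0 v; rewrite /Sigma mulmxDr mulmxDl [leRHS]mxE.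
rewrite mul_mx_scalar -scalemxAl [X in _ <= _ + X]mxE lerDr.
rewrite mulmx_sumr mulmx_suml summxE; apply: sumr_ge0 => n _.
by rewrite -scalemxAr -scalemxAl mxE mulr_ge0 ?ler0c ?Wn_psd.
Qed.

(* Some [t] here leave the box, where only a weaker coercivity constant survives;
   the two-sided derivative at a boundary point needs them. *)
Lemma Sigma_line_coercive a n : (forall m, 0 <= a 0 m) ->
  exists2 e : R, 0 < e <= 1 & forall t, `|t| < e ->
    coercive (sw2 / 2) (Sg (a + t *: e_ n)).
Proof.
move=> a0; have [K K0 KW] := @quadform_bound R _ (Wn n).
(* For such [t] the perturbation costs at most half of [sw2]; the cap 1 lets later estimates absorb
   powers of [t]. *)
exists (Num.min 1 (sw2 / 2 / (K + 1))).
  rewrite lt_min ltr01 ge_min lexx /= andbT divr_gt0 ?divr_gt0 //.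
  by rewrite ltr_wpDl.
move=> t; rewrite lt_min => /andP[_]; rewrite ltr_pdivlMr ?ltr_wpDl // => tK v.
rewrite Sigma_line mulmxDr mulmxDl [leRHS]mxE -scalemxAr -scalemxAl.
rewrite [X in _ <= _ + X]mxE.
apply: le_trans (lerD (Sigma_coercive a0 v) (lexx _)).
move: (KW v) (Wn_psd n v) (mul_ctmx_cV_ge0 v); rewrite (ger0_norm (Wn_psd n v)).
have /complex_realP[x ->] := ger0_real (Wn_psd n v).
have /complex_realP[z ->] := ger0_real (mul_ctmx_cV_ge0 v).
rewrite !ler0c -!rmorphM -rmorphD !lecR => xz x0 z0.
have txz : `|t * x| <= sw2 / 2 * z.
  rewrite normrM (ger0_norm x0).
  apply: le_trans (ler_wpM2l (normr_ge0 t) xz) _.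
  rewrite mulrA ler_wpM2r //; apply: le_trans (ltW tK).
  by rewrite ler_wpM2l // lerDl.
by move: txz; rewrite ler_norml => /andP[txz _]; lra.
Qed.

(* The paper's closed form of the n-th partial derivative, with
   [Si *m Wn n *m Si = Si *m X_n *m ctmx X_n *m Si] giving its squared norm. *)
Definition grad_formula (a : 'rV[R]_N) (n : 'I_N) : R :=
  let Si := invmx (Sg a) in
  complex.Re (\tr (ctmx (Xm n) *m Si *m Xm n)) - 2 * Reform Si (res a) (b n)
  - Reform (Si *m Wn n *m Si) (res a) (res a).

Lemma ctmx_invSigma a : ctmx (invmx (Sg a)) = invmx (Sg a).
Proof. by rewrite ctmx_inv ctmx_Sigma. Qed.

(** Factoring out [Sigma a] leaves the determinant of the identity plus [t] times a matrix, which
    [det_1DZ] expands; the logarithm then cancels the factor [\det (Sigma a)], and cyclicity turns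
    the trace into that of the statement. *)
Lemma is_derive_logdet a n : (forall m, 0 <= a 0 m) ->
  is_derive (0 : R) 1 (fun t : R => ln (complex.Re (\det (Sg (a + t *: e_ n)))))
    (complex.Re (\tr (ctmx (Xm n) *m invmx (Sg a) *m Xm n))).
Proof.
move=> a0; have cS := Sigma_coercive a0.
have uS : Sg a \in unitmx by exact: coercive_unitmx sw2_gt0 cS.
have := coercive_det_gt0 sw2_gt0 (ctmx_Sigma a) cS.
pose d t := complex.Re (\det (Sg (a + t *: e_ n))).
(* Positivity in [R[i]] includes a zero imaginary part, so the determinant equals its real part. *)
rewrite ltcE => /andP[/eqP /= dI dR].
have dE : \det (Sg a) = (complex.Re (\det (Sg a)))%:C.
  by move: dI; case: (\det _) => ? ? /= ->.
set D := complex.Re (\det (Sg a)) in dR dE.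
have [p pE] := det_1DZ (invmx (Sg a) *m Wn n).
have [B pB] := @Re_horner_bound _ p.
have trE : \tr (invmx (Sg a) *m Wn n) = \tr (ctmx (Xm n) *m invmx (Sg a) *m Xm n).
  by rewrite -Xn_ctmx mulmxA mxtrace_mulC mulmxA.
set tau := complex.Re _.
have d0 : d 0 = D by rewrite /d scale0r addr0.
have dtE t : d t = D * (1 + t * tau + t ^+ 2 * complex.Re p.[t%:C]).
  rewrite /d Sigma_line.
  have -> : Sg a + t%:C *: Wn n = Sg a *m (1%:M + t%:C *: (invmx (Sg a) *m Wn n)).
    by rewrite mulmxDr mulmx1 -scalemxAr mulKVmx.
  rewrite det_mulmx dE ReZr pE trE; congr (_ * _).
  by rewrite !ReD ReZr -rmorphXn ReZr.
have dd : is_derive (0 : R) 1 d (D * tau).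
  apply: (@is_derive_quadratic R d 0 (D * tau) 1 (D * B)) => // h h1.
  rewrite add0r d0 dtE.
  have -> : D * (1 + h * tau + h ^+ 2 * complex.Re p.[h%:C]) - D - D * tau * h =
    D * complex.Re p.[h%:C] * h ^+ 2 by ring.
  rewrite normrM normrM [`|h ^+ 2|]ger0_norm ?sqr_ge0 // (gtr0_norm dR).
  by rewrite ler_wpM2r ?sqr_ge0 // ler_pM2l // pB // ltW.
have ld : is_derive (d 0) 1 (@ln R) (d 0)^-1 by apply: is_derive1_ln; rewrite d0.
have := is_derive1_comp ld dd.
by rewrite d0 mulKf ?gt_eqF.
Qed.

Lemma is_derive_quadform a n : (forall m, 0 <= a 0 m) ->
  let Si := invmx (Sg a) in
  is_derive (0 : R) 1
    (fun t : R => Reform (invmx (Sg (a + t *: e_ n))) (res (a + t *: e_ n))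
                         (res (a + t *: e_ n)))
    (- 2 * Reform Si (res a) (b n) - Reform (Si *m Wn n *m Si) (res a) (res a)).
Proof.
move=> a0 Si; have cS := Sigma_coercive a0.
have uS : Sg a \in unitmx by exact: coercive_unitmx sw2_gt0 cS.
have [e /andP[e0 e1] eS] := Sigma_line_coercive n a0.
have sw4 : 0 < sw2 / 2 by rewrite divr_gt0.
pose D (t : R) := `|t| < e.
pose Z (t : R) := invmx (Sg (a + t *: e_ n)).
have bZ : mxbounded D Z.
  exists (sw2 / 2)^-1 => t Dt i j.
  exact: coercive_invmx_bound sw4 (eS t Dt) _ _.
(* The last term of [invmx_perturb]. It depends on [t] through [Z t], and coercivity near 0 bounds
   it uniformly. *)
pose Q t := Si *m Wn n *m Z t *m Wn n *m Si.
have bQ : mxbounded D Q.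
  by do 4?[apply: mxboundedM => //]; apply: mxbounded_cst.
have bu u : mxbounded D (fun=> u : 'cV[R[i]]_(M * L)) by exact: mxbounded_cst.
set rr := res a; set P := Si *m Wn n *m Si.
have [B1 B10 rQr] := mxbounded_Reform bQ (bu rr) (bu rr).
have [B2 B20 bQr] := mxbounded_Reform bQ (bu (b n)) (bu rr).
have [B3 B30 rQb] := mxbounded_Reform bQ (bu rr) (bu (b n)).
have [B4 B40 bQb] := mxbounded_Reform bQ (bu (b n)) (bu (b n)).
pose K1 := Reform Si (b n) (b n) + Reform P (b n) rr + Reform P rr (b n).
pose K2 := Reform P (b n) (b n).
apply: (@is_derive_quadratic R _ 0 _ e (`|K1| + `|K2| + B1 + B2 + B3 + B4)) => //.
move=> h he; rewrite add0r scale0r addr0 res_line -/rr -/Si.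
have h1 : `|h| <= 1 by apply: le_trans e1; apply: ltW.
have uSh : Sg a + h%:C *: Wn n \in unitmx.
  by rewrite -Sigma_line; apply: coercive_unitmx sw4 (eS h he).
have -> : invmx (Sg (a + h *: e_ n)) = Si - h%:C *: (P - h%:C *: Q h).
  by rewrite /Q /Z Sigma_line; apply: invmx_perturb.
rewrite (Reform_expansion P (Q h) rr (b n) h (ctmx_invSigma a)) -/Si.
exact: (quartic_remainder_bound _ _ K1 K2 h1 (rQr h he) (bQr h he) (rQb h he)
  (bQb h he)).
Qed.

Lemma is_derive_fobj0 a n : (forall m, 0 <= a 0 m) ->
  is_derive (0 : R) 1 (fun t : R => f (a + t *: e_ n)) (grad_formula a n).
Proof.
move=> a0; have := is_deriveD (is_derive_logdet n a0) (is_derive_quadform n a0).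
by rewrite mulNr addrA.
Qed.

Lemma is_derive_fobj a n t : (forall m, 0 <= (a + t *: e_ n) 0 m) ->
  is_derive t 1 (fun u : R => f (a + u *: e_ n)) (grad_formula (a + t *: e_ n) n).
Proof.
move=> a0.
have -> : (fun u : R => f (a + u *: e_ n)) =
    (fun u : R => f ((a + t *: e_ n) + u *: e_ n)) \o (fun u : R => u - t).
  by apply/funext => u /=; rewrite -addrA -scalerDl subrKC.
rewrite -[grad_formula _ _]mulr1; apply: is_derive1_comp.
  by rewrite subrr; apply: is_derive_fobj0.
by apply: is_derive_eq; rewrite subr0.
Qed.

(** This includes boundary points of the box, where the derivative is still two-sided. *)
Lemma gradfE a n : (forall m, 0 <= a 0 m) ->
  gradf s hb Rm sw2 y a n = grad_formula a n.
Proof. by move=> /(is_derive_fobj0 n)[_ df]; rewrite /gradf derive1E. Qed.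


(** * The quartic as a uniform second-order approximation *)

(** Multiplied by [Si] on both sides, the middle matrix of [p_approx] becomes [P - d Y]. Collecting
    powers of [d] shows that the quartic is tangent to the objective at [d = 0]. *)
Lemma p_approx_expansion a n d :
  let Si := invmx (Sg a) in
  let Y := Si *m (Xm n *m (ctmx (Xm n) *m Si *m Xm n) *m ctmx (Xm n)) *m Si in
  let P := Si *m Wn n *m Si in
  p_approx s hb Rm Rh sw2 y a n d = f a + grad_formula a n * d
  + (Reform Si (b n) (b n) + Reform Y (res a) (res a) + 2 * Reform P (res a) (b n))
    * d ^+ 2
  - (2 * Reform Y (res a) (b n) + Reform P (b n) (b n)) * d ^+ 3
  + Reform Y (b n) (b n) * d ^+ 4.
Proof.
move=> Si Y P; rewrite /p_approx -/Si.
set G := ctmx (Xm n) *m Si *m Xm n; set K := Xm n *m _ *m _.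
have KE : Si *m K *m Si = P - d%:C *: Y.
  rewrite /K mulmxBr mulmx1 mulmxBl Xn_ctmx -scalemxAr -scalemxAl.
  by rewrite mulmxBr mulmxBl -scalemxAr -scalemxAl.
have formE (u v : 'cV_(M * L)) :
    complex.Re ((ctmx u *m Si *m K *m Si *m v) 0 0) =
    Reform P u v - d * Reform Y u v.
  by rewrite -ReformB -KE /Reform !mulmxA.
(* Replacing the forms by real variables leaves a polynomial identity. *)
have regroup (g0 T x x1 k1 p1 y1 k2 p2 y2 k3 p3 y3 : R) :
    k1 = p1 - d * y1 -> k2 = p2 - d * y2 -> k3 = p3 - d * y3 ->
    g0 + d * T - 2 * d * x + d ^+ 2 * x1 - d * k1 + 2 * d ^+ 2 * k2 - d ^+ 3 * k3 =
    g0 + (T - 2 * x - p1) * d + (x1 + y1 + 2 * p2) * d ^+ 2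
      - (2 * y2 + p3) * d ^+ 3 + y3 * d ^+ 4.
  by move=> -> -> ->; ring.
exact: regroup (formE (res a) (res a)) (formE (res a) (b n)) (formE (b n) (b n)).
Qed.

Lemma inbox_ge0 a : inbox a -> forall m, 0 <= a 0 m.
Proof. by move=> a01 m; have /andP[] := a01 m. Qed.

(** Each coefficient beyond the linear one is built from fixed matrices, the residual and the
    inverse of [Sigma a], all bounded over the box. *)
Lemma p_approx_bound n : exists2 B : R, 0 <= B & forall a d,
  inbox a -> `|d| <= 1 ->
  `|p_approx s hb Rm Rh sw2 y a n d - f a - grad_formula a n * d| <= B * d ^+ 2.
Proof.
pose D a := inbox a.
have bS : mxbounded D (fun a => invmx (Sg a)).
  exists (sw2^-1) => a /inbox_ge0 a0 i j.
  exact: coercive_invmx_bound sw2_gt0 (Sigma_coercive a0) _ _.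
have br : mxbounded D (fun a => res a).
  apply: mxboundedD; first exact: mxbounded_cst.
  apply/mxboundedN/mxbounded_sum => m; apply: mxboundedZ (mxbounded_cst _ _).
  by move=> a /(_ m)/andP[a0 a1]; rewrite ger0_norm.
have bb : mxbounded D (fun=> b n) by exact: mxbounded_cst.
have bP : mxbounded D (fun a => invmx (Sg a) *m Wn n *m invmx (Sg a)).
  by do 2?[apply: mxboundedM => //]; apply: mxbounded_cst.
have bY : mxbounded D (fun a => invmx (Sg a) *m (Xm n *m
    (ctmx (Xm n) *m invmx (Sg a) *m Xm n) *m ctmx (Xm n)) *m invmx (Sg a)).
  by do 6?[apply: mxboundedM => //]; apply: mxbounded_cst.
have [B1 B10 h1] := mxbounded_Reform bS bb bb.
have [B2 B20 h2] := mxbounded_Reform bY br br.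
have [B3 B30 h3] := mxbounded_Reform bP br bb.
have [B4 B40 h4] := mxbounded_Reform bY br bb.
have [B5 B50 h5] := mxbounded_Reform bP bb bb.
have [B6 B60 h6] := mxbounded_Reform bY bb bb.
exists (B1 + B2 + 2 * B3 + (2 * B4 + B5) + B6); first by lra.
move=> a d a01 d1; rewrite p_approx_expansion.
apply: quartic_tail_bound d1 (h1 a a01) (h2 a a01) (h3 a a01) (h4 a a01) (h5 a a01)
  (h6 a a01).
Qed.

Lemma p_approx_bound_uniform : exists2 B : R, 0 <= B & forall a n d,
  inbox a -> `|d| <= 1 ->
  `|p_approx s hb Rm Rh sw2 y a n d - f a - grad_formula a n * d| <= B * d ^+ 2.
Proof.
have /choice [B BP] : forall n, exists B : R, 0 <= B /\ forall a d,
  inbox a -> `|d| <= 1 ->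
  `|p_approx s hb Rm Rh sw2 y a n d - f a - grad_formula a n * d| <= B * d ^+ 2.
  by move=> n; have [B B0 BP] := p_approx_bound n; exists B.
(* A sum of nonnegative constants dominates each of them. *)
exists (\sum_n B n); first by apply: sumr_ge0 => n _; have [] := BP n.
move=> a n d a01 d1; have [_ /(_ a d a01 d1)] := BP n; move/le_trans; apply.
rewrite ler_wpM2r ?sqr_ge0 // (bigD1 n) //= lerDl.
by apply: sumr_ge0 => m _; have [] := BP m.
Qed.

(** * Lipschitz descent along a coordinate *)

Lemma inbox_line a n d t : inbox a -> - a 0 n <= d <= 1 - a 0 n ->
  0 <= t <= 1 -> inbox (a + (t * d) *: e_ n).
Proof.
move=> a01 dn t01 m; rewrite !mxE /=; have := a01 m.
have [->|_] := eqVneq m n; last by rewrite mulr0 addr0.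
by rewrite mulr1 => am; apply/andP; split; nra.
Qed.

Lemma fobj_descent ell a n d : grad_lipschitz s hb Rm sw2 y ell ->
  inbox a -> - a 0 n <= d <= 1 - a 0 n ->
  f (a + d *: e_ n) <= f a + grad_formula a n * d + ell / 2 * d ^+ 2.
Proof.
move=> lip a01 dn.
pose g (t : R) := f (a + (t * d) *: e_ n).
pose dg (t : R) := grad_formula (a + (t * d) *: e_ n) n * d.
(* The segment is parametrized by [[0, 1]]: one factor [d] comes from the chain rule, the other from
   the distance [|t * d|] in the Lipschitz bound. *)
have := @descent_unit_interval R g dg (ell * d ^+ 2).
rewrite /g /dg mul1r mul0r scale0r addr0 mulrAC; apply.
  move=> t t01; have a0 := inbox_ge0 (inbox_line a01 dn t01).
  apply: (is_derive1_comp (f := fun u => f (a + u *: e_ n)) (g := fun t => t * d)).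
    exact: is_derive_fobj.
  by apply: is_derive_eq; rewrite /GRing.scale /= mulr0 mulr1 add0r.
move=> t t01; have t0 : 0 <= t by case/andP: t01.
have b01 := inbox_line a01 dn t01.
set c := a + (t * d) *: e_ n in b01 *.
have := lip c a b01 a01.
have -> : c - a = (t * d) *: e_ n by rewrite /c addrC addKr.
have -> : norm2 ((t * d) *: e_ n : 'rV[R]_N) = `|t * d|.
  rewrite /norm2 (bigD1 n) //= big1 ?addr0 => [|m mn].
    by rewrite !mxE !eqxx mulr1 sqrtr_sqr.
  by rewrite !mxE /= (negPf mn) mulr0 expr0n.
have le_norm2 : `|gradf s hb Rm sw2 y c n - gradf s hb Rm sw2 y a n| <=
    norm2 (\row_m (gradf s hb Rm sw2 y c m - gradf s hb Rm sw2 y a m)).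
  rewrite -sqrtr_sqr /norm2; apply: ler_wsqrtr; rewrite (bigD1 n) //= mxE lerDl.
  by apply: sumr_ge0 => m _; apply: sqr_ge0.
move=> /(le_trans le_norm2); rewrite !gradfE; [|exact: inbox_ge0..].
rewrite normrM (ger0_norm t0) => gl.
rewrite -mulrBl; apply: le_trans (ler_norm _) _; rewrite normrM.
apply: le_trans (ler_wpM2r (normr_ge0 d) gl) _.
by rewrite -[d ^+ 2]real_normK ?num_real // (_ : _ * `|d| = ell * `|d| ^+ 2 * t) //; ring.
Qed.

End Model.

(** * The projected step and the resulting decrease *)

(** The second part is the variational inequality of the projection of [x - g], tested at the
    feasible point [x]. *)
Lemma proj01_step (R : realType) (x g : R) : 0 <= x <= 1 ->
  let v := proj01 (x - g) - x in - x <= v <= 1 - x /\ g * v <= - v ^+ 2.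
Proof.
move=> x01; rewrite /proj01 /Num.max /Num.min /=.
case: (ltP (x - g) 1) => h1; case: ifP => h2; split; first [nra | apply/andP; split; lra].
Qed.

Lemma prox_step_decrease (R : realFieldType) (p : R -> R)
    (x g v F0 Fd B ell mu d : R) :
  0 <= x <= 1 -> 0 <= B -> 0 < ell -> ell + (2 * B + 1) <= mu ->
  - x <= d <= 1 - x -> - x <= v <= 1 - x -> g * v <= - v ^+ 2 ->
  Fd <= F0 + g * d + ell / 2 * d ^+ 2 ->
  (forall e, `|e| <= 1 -> `|p e - F0 - g * e| <= B * e ^+ 2) ->
  (forall e, - x <= e <= 1 - x -> p d + mu / 2 * d ^+ 2 <= p e + mu / 2 * e ^+ 2) ->
  Fd <= F0 - v ^+ 2 / (2 * (mu + (2 * B + 1))).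
Proof.
move=> /andP[x0 x1] B0 ell0 muB /andP[dx dx1] /andP[vx vx1] gv descent pB dmin.
set K := mu + _; have K1 : 1 <= K by rewrite /K; lra.
have K0 : 0 < K by exact: lt_le_trans K1.
have [Ki0 Ki1] : 0 <= K^-1 /\ K^-1 <= 1.
  by rewrite invr_ge0 (ltW K0); split=> //; rewrite invf_le1.
(* The comparison point. It is feasible because [K >= 1] and the interval contains both 0 and [v];
   among multiples of [v] it minimizes the bound [- v * u + K / 2 * u ^+ 2], up to the scaling of
   [v]. *)
pose u := v / K.
have [ux ux1] : - x <= u /\ u <= 1 - x.
  by rewrite /u; move: (K^-1) Ki0 Ki1 => k *; split; nra.
have step : g * u + K / 2 * u ^+ 2 <= - (v ^+ 2 / (2 * K)).
  have -> : - (v ^+ 2 / (2 * K)) = - v ^+ 2 / K + K / 2 * u ^+ 2.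
    by rewrite /u; field; rewrite gt_eqF.
  by rewrite lerD2r mulrA ler_wpM2r.
(* Half of this pays at [d] for the descent error [ell / 2 * d ^+ 2] and the approximation error
   [B * d ^+ 2]. *)
have d2 : (ell + 2 * B) * d ^+ 2 <= mu * d ^+ 2.
  by apply: ler_wpM2r; [exact: sqr_ge0 | lra].
have u2 : (mu + 2 * B) * u ^+ 2 <= K * u ^+ 2.
  by apply: ler_wpM2r; [exact: sqr_ge0 | rewrite /K; lra].
have pd : - (B * d ^+ 2) <= p d - F0 - g * d.
  have /pB : `|d| <= 1 by rewrite ler_norml; apply/andP; split; lra.
  by rewrite ler_norml => /andP[].
have pu : p u - F0 - g * u <= B * u ^+ 2.
  have /pB : `|u| <= 1 by rewrite ler_norml; apply/andP; split; lra.
  by rewrite ler_norml => /andP[].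
have pdu := dmin u (introT andP (conj ux ux1)).
move: descent step d2 u2 pd pu pdu; clear; move: (p d) (p u) => pd pu; lra.
Qed.

Theorem theorem1 (R : realType) (L M N : nat)
  (s : 'I_N -> 'cV[R[i]]_L) (hb : 'I_N -> 'cV[R[i]]_M)
  (Rm : 'I_N -> 'M[R[i]]_M) (r : 'I_N -> nat)
  (Rh : forall n : 'I_N, 'M[R[i]]_(M, r n))
  (sw2 : R) (y : 'cV[R[i]]_(M * L)) (ell : R) :
  (0 < L)%N -> (0 < M)%N -> (0 < N)%N -> 0 < sw2 ->
  (forall n, ctmx (Rm n) = Rm n) ->
  (forall n (v : 'cV[R[i]]_M), 0 <= (ctmx v *m Rm n *m v) 0 0) ->
  (forall n, \rank (Rm n) = r n) ->
  (forall n, Rh n *m ctmx (Rh n) = Rm n) ->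
  0 < ell -> grad_lipschitz s hb Rm sw2 y ell ->
  exists c : R, 0 < c /\
    forall (a : 'rV[R]_N) (n : 'I_N) (mu dbar : R),
      inbox a -> ell + c <= mu ->
      - a 0 n <= dbar <= 1 - a 0 n ->
      (forall d : R, - a 0 n <= d <= 1 - a 0 n ->
         p_approx s hb Rm Rh sw2 y a n dbar + mu / 2 * dbar ^+ 2
         <= p_approx s hb Rm Rh sw2 y a n d + mu / 2 * d ^+ 2) ->
      fobj s hb Rm sw2 y (a + dbar *: e_ n)
      <= fobj s hb Rm sw2 y a - (Vf s hb Rm sw2 y a n) ^+ 2 / (2 * (mu + c)).
Proof.
move=> _ _ _ sw2_gt0 _ _ _ RhE ell_gt0 lip.
have [B B0 pB] := p_approx_bound_uniform s hb y sw2_gt0 RhE.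
(* The term [2 * B] covers the approximation error, doubled against the factor 1/2 of the proximal
   term; the added 1 keeps [c] positive when [B = 0] and gives [mu + c >= 1]. *)
exists (2 * B + 1); split; first by rewrite ltr_wpDl // mulr_ge0.
move=> a n mu d a01 muc dn dmin; have a0 := inbox_ge0 a01.
rewrite /Vf (gradfE s hb y sw2_gt0 RhE n a0) real_normK ?num_real //.
have [vn gv] := proj01_step (grad_formula s hb Rm Rh sw2 y a n) (a01 n).
exact: prox_step_decrease (a01 n) B0 ell_gt0 muc dn vn gv
  (fobj_descent sw2_gt0 RhE lip a01 dn) (fun e => pB a n e a01) dmin.
Qed.
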